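(* The quadratic dependence on $[w]_{A_1}$ in the weighted weak type $(1,1)$ estimate \[ |\{x\in\mathbb{R}^d: w(x)|T(fw^{-1})(x)|>\alpha\}|\le \frac{C[w]_{A_1}^2}{\alpha}\int_{\mathbb{R}^d}|f|\,dx \] is sharp in the scalar setting, both for $T=H$ (the Hilbert transform) and for $T=M$ (the Hardy--Littlewood maximal operator). Precisely: there is an absolute constant $c>0$ and a sequence of weights $w_N\in A_1(\mathbb{R})$ with $[w_N]_{A_1}\to\infty$ such that for each $N$ there is a nonzero $f_N\in L^1(\mathbb{R})$ with \[ \sup_{\alpha>0}\alpha\,\big|\{x\in\mathbb{R}: w_N(x)|T(f_Nw_N^{-1})(x)|>\alpha\}\big|\ge c\,[w_N]_{A_1}^2\int_{\mathbb{R}}|f_N|\,dx \] for both $T=H$ and $T=M$. In particular, for neither operator can $[w]_{A_1}^2$ be replaced by $\varphi([w]_{A_1})$ with $\varphi(t)/t^2\to0$ as $t\to\infty$.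
   Context: A weight is a non-negative locally integrable function $w$. It belongs to $A_1$ if there is $C>0$ with $\frac{1}{|Q|}\int_Q w\le C\,\operatorname{ess\,inf}_Q w$ for every cube (in dimension one: interval) $Q$; the smallest such $C$ is $[w]_{A_1}$. The Hardy--Littlewood maximal operator is $Mf(x)=\sup_{Q\ni x}\frac1{|Q|}\int_Q|f|$, and the Hilbert transform is $Hf(x)=\mathrm{p.v.}\int_{\mathbb{R}}\frac{f(y)}{x-y}\,dy$ (the normalizing constant is irrelevant). *)

(* Defs.v *)
From mathcomp Require Import all_boot all_order all_algebra.
From mathcomp Require Import all_classical all_reals all_analysis.
Import Order.TTheory GRing.Theory Num.Theory.
Import numFieldNormedType.Exports.
Set Implicit Arguments. Unset Strict Implicit. Unset Printing Implicit Defensive.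
Local Open Scope ring_scope.
Local Open Scope classical_set_scope.

Section Defs.
Variable R : realType.
Local Notation leb := (@lebesgue_measure R).

Definition is_weight (w : R -> R) : Prop :=
  (forall x, 0 <= w x) /\ (forall a b : R, leb.-integrable `[a, b] (EFin \o w)).

Definition avg (w : R -> R) (a b : R) : R :=
  (b - a)^-1 * Rintegral leb `[a, b] w.

(* (1/|Q|) int_Q w <= C ess inf_Q w, for every interval Q = [a,b], a < b;
   "avg <= C * essinf_Q w" is written out as "avg <= C * w x for a.e. x in Q" *)
Definition A1_cond (w : R -> R) (C : R) : Prop :=
  0 < C /\ forall a b : R, a < b ->
    {ae leb, forall x, x \in `[a, b] -> avg w a b <= C * w x}.

Definition A1 (w : R -> R) : Prop :=
  is_weight w /\ exists C, A1_cond w C.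

Definition A1_const (w : R -> R) : R := inf [set C | A1_cond w C].

Definition maximal (f : R -> R) (x : R) : \bar R :=
  ereal_sup [set v | exists a b : R, a < b /\ a <= x <= b /\
     v = (((b - a)^-1)%:E * \int[leb]_(y in `[a, b]) (`|f y|)%:E)%E].

Definition hilbert_trunc (f : R -> R) (x eps : R) : R :=
  Rintegral leb [set y | eps < `|x - y|] (fun y => f y / (x - y)).

Definition hilbert_pv (f : R -> R) (x L : R) : Prop :=
  hilbert_trunc f x eps @[eps --> (0:R)^'+] --> L.

Definition level_H (w f : R -> R) (alpha : R) : set R :=
  [set x | exists L, hilbert_pv (fun y => f y / w y) x L /\ alpha < w x * `|L|].

Definition level_M (w f : R -> R) (alpha : R) : set R :=
  [set x | (alpha%:E < (w x)%:E * maximal (fun y => (f y / w y)%R) x)%E].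

Definition weak_norm (E : R -> set R) : \bar R :=
  ereal_sup [set (alpha%:E * leb (E alpha))%E | alpha in [set a : R | 0 < a]].

End Defs.

(* Main.v *)
(** Let [f] be the indicator function of [0, 1]. Then [M f] and [|H f|] are at
    least [1 / x] to its right. The weight [w] is [1] near [f]; around each of the
    points [p = 4 L], [L = 2, 4, ..., 2^N], it equals [N L] on [p - 1, p + 1] and
    decays like [L / |x - p|] down to [1] at distance [L]. Each tooth has total
    excess mass of order [N L], spread over a scale [L] on which [w >= 1], so the
    [A_1] constant is of order [N]. On each plateau [w / x >= N / 5], so at the
    single level [alpha = N / 6] all [N] plateaux are in the level set, and
    [alpha |{w |T(f / w)| > alpha}| >= N^2 / 3]. *)
Require Import Defs.
From mathcomp Require Import all_boot all_order all_algebra.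
From mathcomp Require Import all_classical all_reals all_analysis.
From mathcomp Require Import measurable_realfun lra.
Import Order.TTheory GRing.Theory Num.Theory.
Import numFieldNormedType.Exports.
Local Open Scope ring_scope.
Local Open Scope classical_set_scope.

Set Implicit Arguments.
Unset Strict Implicit.

Section Weights.
Context {R : realType}.
Local Notation mu := (@lebesgue_measure R).
Implicit Types (a b c p q x y C H L : R) (u v w : R -> R) (n N : nat).

(** * Integrals over intervals: comparison with constants and indicators *)

Lemma lebesgue_measure_itvcc a b : a <= b -> mu `[a, b] = (b - a)%:E.
Proof.
rewrite le_eqVlt => /orP[/eqP->|ab]; rewrite lebesgue_measure_itv /= lte_fin.
  by rewrite ltxx subrr.
by rewrite ab EFinB.
Qed.

Lemma eq_integral_EFin (A : set R) (f g : R -> R) :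
  (forall y, A y -> f y = g y) ->
  (\int[mu]_(y in A) (f y)%:E = \int[mu]_(y in A) (g y)%:E)%E.
Proof. by move=> fg; apply: eq_integral => y; rewrite inE => /fg ->. Qed.

(** One step of the layer-by-layer estimate of a tooth: an excess of at most [c] on [[a, b]] costs
    at most [c * (b - a)], whatever part of [[a, b]] lies in [D]. *)
Lemma integral_le_add_indic (D : set R) (f g : R -> R) c a b :
  measurable D -> measurable_fun setT f -> measurable_fun setT g ->
  (forall x, 0 <= f x) -> (forall x, 0 <= g x) -> 0 <= c -> a <= b ->
  (forall x, g x <= f x + c * \1_`[a, b] x) ->
  (\int[mu]_(x in D) (g x)%:E
   <= \int[mu]_(x in D) (f x)%:E + (c * (b - a))%:E)%E.
Proof.
move=> mD mf mg f0 g0 c0 ab gle.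
have mI : measurable_fun setT (fun x => (\1_(`[a, b] : set R) x : R)).
  exact: measurable_indic.
have i0 x : 0 <= (\1_(`[a, b] : set R) x : R) by rewrite indicE; case: (_ \in _).
have -> : (c * (b - a))%:E = (c%:E * mu `[a, b])%E.
  by rewrite lebesgue_measure_itvcc// EFinM.
have le1 : (\int[mu]_(x in D) (g x)%:E
    <= \int[mu]_(x in D) ((f x)%:E + c%:E * (\1_(`[a, b] : set R) x)%:E))%E.
  apply: ge0_le_integral => //.
  - by move=> x _; rewrite lee_fin.
  - by apply/measurable_EFinP; apply: measurable_funTS.
  - apply: emeasurable_funD.
      by apply/measurable_EFinP; apply: measurable_funTS.
    apply: emeasurable_funM; first exact: measurable_cst.
    by apply/measurable_EFinP; apply: measurable_funTS.
  - by move=> x _; rewrite -EFinM -EFinD lee_fin.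
apply: (le_trans le1); rewrite ge0_integralD //; first last.
- apply: emeasurable_funM; first exact: measurable_cst.
  by apply/measurable_EFinP; apply: measurable_funTS.
- by move=> x _; rewrite mule_ge0// lee_fin.
- by apply/measurable_EFinP; apply: measurable_funTS.
- by move=> x _; rewrite lee_fin.
apply: leeD2l; rewrite ge0_integralZl_EFin //; last first.
  by apply/measurable_EFinP; apply: measurable_funTS.
apply: lee_pmul => //; first by apply: integral_ge0 => x _; rewrite lee_fin.
rewrite integral_indic //; apply: le_measure; rewrite ?inE //.
exact: measurableI.
Qed.

Lemma integral_itv_le_cst w a b C :
  measurable_fun setT w -> (forall x, 0 <= w x) -> a <= b ->
  (forall y, a <= y <= b -> w y <= C) ->
  (\int[mu]_(y in `[a, b]) (w y)%:E <= (C * (b - a))%:E)%E.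
Proof.
move=> mw w0 ab wC.
rewrite EFinM -lebesgue_measure_itvcc // -integral_cst //.
apply: ge0_le_integral => //.
- by move=> x _; rewrite lee_fin.
- by apply/measurable_EFinP; apply: measurable_funTS.
Qed.

(** * A pointwise form of the [A_1] condition, and gluing *)

(** Asked at every [x] rather than almost every [x], so that it can be tested at one chosen point,
    such as the cut point in a gluing. *)
Definition pointwise_A1 C w := forall a b x, a < b -> a <= x <= b ->
  (\int[mu]_(y in `[a, b]) (w y)%:E <= (C * (b - a) * w x)%:E)%E.

(* An interval containing [q] is cut at [q], where both weights attain their
   common minimum, and its two halves are tested at [q]. *)
Lemma pointwise_A1_glue C u v q :
  measurable_fun setT u -> measurable_fun setT v -> 0 < C ->
  (forall x, 1 <= u x) -> (forall x, 1 <= v x) -> u q = 1 -> v q = 1 ->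
  pointwise_A1 C u -> pointwise_A1 C v ->
  pointwise_A1 C (fun x => if x < q then u x else v x).
Proof.
move=> mu_ mv C0 u1 v1 uq vq Au Av.
set w := fun x => if _ then _ else _; move=> a b x ab axb.
have w1 y : 1 <= w y by rewrite /w; case: ifP.
have u0 y : 0 <= u y by rewrite (le_trans ler01).
have v0 y : 0 <= v y by rewrite (le_trans ler01).
case: (ltP b q) => bq.
  rewrite (_ : w x = u x); last by rewrite /w (le_lt_trans _ bq) //; case/andP: axb.
  rewrite (@eq_integral_EFin _ w u); first exact: Au.
  by move=> y; rewrite /= in_itv /= => /andP[_ yb]; rewrite /w (le_lt_trans yb bq).
case: (leP q a) => qa.
  rewrite (_ : w x = v x); last first.
    by rewrite /w ltNge (le_trans qa) //; case/andP: axb.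
  rewrite (@eq_integral_EFin _ w v); first exact: Av.
  by move=> y; rewrite /= in_itv /= => /andP[ay _]; rewrite /w ltNge (le_trans qa ay).
have mw : measurable_fun setT w.
  apply: measurable_fun_ifT => //.
  by apply: measurable_fun_ltr => //; exact: measurable_cst.
rewrite (@itv_bndbnd_setU _ _ (BLeft a) (BLeft q) (BRight b)) ?bnd_simp //; last exact: ltW.
rewrite ge0_integral_setU //; first last.
- apply/disj_setPS => y [] /=; rewrite !in_itv /= => /andP[_ yq] /andP[qy _].
  by move: (lt_le_trans yq qy); rewrite ltxx.
- by move=> y _; rewrite lee_fin (le_trans ler01).
- by apply/measurable_EFinP; apply: measurable_funTS.
have I1 : (\int[mu]_(y in `[a, q[) (w y)%:E <= (C * (q - a))%:E)%E.
  rewrite (@eq_integral_EFin _ w u); last first.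
    by move=> y; rewrite /= in_itv /= => /andP[_ yq]; rewrite /w yq.
  rewrite -[C * _]mulr1 -uq.
  apply: le_trans (Au a q q qa _); last by rewrite lexx (ltW qa).
  apply: ge0_subset_integral => //.
  - by apply/measurable_EFinP; apply: measurable_funTS.
  - by move=> y _; rewrite lee_fin.
  - by move=> y /=; rewrite !in_itv /= => /andP[-> /ltW ->].
have I2 : (\int[mu]_(y in `[q, b]) (w y)%:E <= (C * (b - q))%:E)%E.
  rewrite (@eq_integral_EFin _ w v); last first.
    by move=> y; rewrite /= in_itv /= => /andP[qy _]; rewrite /w ltNge qy.
  (* The right half may shrink to the point [q]; the hypothesis on [v] speaks only of nondegenerate
     intervals. *)
  move: bq; rewrite le_eqVlt => /orP[/eqP<-|qb].
    rewrite subrr mulr0 -(mulr0 1) -(subrr q).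
    apply: integral_itv_le_cst => // y /andP[qy yq].
    by rewrite (_ : y = q) ?vq //; apply/le_anti/andP.
  rewrite -[C * _]mulr1 -vq.
  by apply: Av => //; rewrite lexx (ltW qb).
apply: (le_trans (leeD I1 I2)).
rewrite -EFinD lee_fin -mulrDr (_ : q - a + (b - q) = b - a); last by lra.
by rewrite ler_peMr // mulr_ge0 // ?ltW // subr_gt0.
Qed.

(** * A single tooth and its [A_1] bound *)

(** With [H = N * L] the profile drops by a factor [N] at the edge of the plateau. The maximum with
    [1] ends the tail at distance [L]. *)
Definition peak p H L x : R :=
  if `|x - p| <= 1 then H else Num.max 1 (L * `|x - p|^-1).

Lemma measurable_inv_dist p : measurable_fun setT (fun x : R => `|x - p|^-1).
Proof.
(* At [x = p] both sides are [0] by convention. *)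
rewrite (_ : (fun x => _) = (fun x => `|x - p| `^ (-1))); last first.
  by apply/funext => x; rewrite powR_inv1.
apply: (measurableT_comp (measurable_powR _)).
apply: (measurableT_comp (@normr_measurable R setT)).
by apply: measurable_funB => //; exact: measurable_cst.
Qed.

Lemma measurable_dist_le p c : measurable_fun setT (fun x : R => `|x - p| <= c).
Proof.
apply: measurable_fun_ler; last exact: measurable_cst.
apply: (measurableT_comp (@normr_measurable R setT)).
by apply: measurable_funB => //; exact: measurable_cst.
Qed.

Lemma measurable_peak p H L : measurable_fun setT (peak p H L).
Proof.
apply: measurable_fun_ifT; first exact: measurable_dist_le.
  exact: measurable_cst.
apply: measurable_maxr; first exact: measurable_cst.
apply: measurable_funM; first exact: measurable_cst.
exact: measurable_inv_dist.
Qed.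

Lemma peak_ge1 p H L x : 1 <= H -> 1 <= peak p H L x.
Proof. by move=> H1; rewrite /peak; case: ifP => // _; rewrite le_max lexx. Qed.

Lemma peak_eq1 p H L x : 1 < `|x - p| -> L <= `|x - p| -> peak p H L x = 1.
Proof.
move=> d1 dL; rewrite /peak leNgt d1 /=; apply/max_idPl.
by rewrite ler_pdivrMr ?mul1r // (lt_trans ltr01).
Qed.

(* Dyadic induction: the shell [2^n < |y - p| <= 2^(n+1)] contributes at most
   [4 L], since [peak p H L <= 1 + L / 2^n] there. *)
Lemma integral_peak_trunc p H L n a b : 1 <= H -> 0 <= L -> a <= b ->
  (\int[mu]_(y in `[a, b]) (if `|y - p| <= 2 ^+ n then peak p H L y else 1)%:E
   <= (b - a + 2 * H + 4 * n%:R * L)%:E)%E.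
Proof.
move=> H1 L0 ab.
have mT k : measurable_fun setT
    (fun y => if `|y - p| <= 2 ^+ k then peak p H L y else 1).
  apply: measurable_fun_ifT; first exact: measurable_dist_le.
    exact: measurable_peak.
  exact: measurable_cst.
have T0 k y : 0 <= if `|y - p| <= 2 ^+ k then peak p H L y else 1.
  by case: ifP => // _; rewrite (le_trans ler01) // peak_ge1.
elim: n => [|n IHn].
  (* At scale [2 ^+ 0] only the plateau differs from [1]: height [H] on length [2]. *)
  have := @integral_le_add_indic `[a, b] (fun=> 1) _ H (p - 1) (p + 1)
    (measurable_itv _) (measurable_cst _) (mT 0) (fun=> ler01) (T0 0).
  have -> : (\int[mu]_(x in `[a, b]) 1 = (b - a)%:E)%E.
    by rewrite integral_cst // mul1e; exact: lebesgue_measure_itvcc.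
  move=> /(_ (le_trans ler01 H1)) I.
  rewrite mulr0 mul0r addr0.
  rewrite [in leRHS](_ : b - a + 2 * H = b - a + H * (p + 1 - (p - 1))); last by lra.
  rewrite EFinD; apply: I; first by lra.
  move=> x; rewrite indicE.
  case: ifPn => [xp|xp].
    rewrite /peak expr0 in xp *; rewrite xp mem_set ?mulr1 ?lerDr //=.
    by move: xp; rewrite in_itv /= ler_norml => /andP[? ?]; apply/andP; split; lra.
  by rewrite lerDl mulr_ge0 // (le_trans ler01 H1).
have e0 : 0 < (2 : R) ^+ n by rewrite exprn_gt0.
(* The excess is charged to the whole ball instead of the shell, which keeps the set an interval at
   the cost of a factor [2]. *)
have := @integral_le_add_indic `[a, b] _ _ (L / 2 ^+ n) (p - 2 ^+ n.+1) (p + 2 ^+ n.+1)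
    (measurable_itv _) (mT n) (mT n.+1) (T0 n) (T0 n.+1).
have -> : L / 2 ^+ n * (p + 2 ^+ n.+1 - (p - 2 ^+ n.+1)) = 4 * L.
  rewrite (_ : _ - _ = 2 ^+ n * 4); last by rewrite exprS; lra.
  by rewrite mulrA divfK ?gt_eqF // mulrC.
move=> I.
apply: le_trans (I _ _ _) _.
- by rewrite divr_ge0 // ltW.
- have := exprn_gt0 n.+1 (@ltr0Sn R 1); lra.
- move=> x; rewrite indicE.
  have c0 : 0 <= L / 2 ^+ n by rewrite divr_ge0 // ltW.
  case: ifPn => [xp1|xp1]; last first.
    rewrite [in leRHS]ifF ?lerDl ?mulr_ge0 ?ler0n //.
    apply/negbTE; move: xp1; rewrite -!ltNge; apply: le_lt_trans.
    by rewrite exprS; lra.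
  case: ifPn => [xp|]; first by rewrite lerDl mulr_ge0.
  rewrite -ltNge => xp.
  rewrite mem_set; last first.
    rewrite /= in_itv /=; move: xp1; rewrite ler_norml => /andP[? ?].
    by apply/andP; split; lra.
  rewrite mulr1 /peak ifF; last first.
    apply/negbTE; rewrite -ltNge (le_lt_trans _ xp) // exprn_ege1 //; lra.
  rewrite ge_max lerDl c0 /=.
  apply: (@le_trans _ _ (L / 2 ^+ n)); last by rewrite lerDr.
  rewrite ler_wpM2l // lef_pV2 ?posrE //; first exact: ltW.
  exact: lt_trans xp.
- apply: le_trans (leeD2r _ IHn) _.
  rewrite -EFinD lee_fin -natr1; lra.
Qed.

Lemma peak_le p H L x : 1 <= H -> L <= H -> 0 <= L -> peak p H L x <= H.
Proof.
move=> H1 LH L0; rewrite /peak; case: ifPn => //; rewrite -ltNge => d1.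
rewrite ge_max H1 /=.
rewrite ler_pdivrMr ?(lt_trans ltr01) // (le_trans LH) // ler_peMr ?ltW //.
exact: lt_le_trans H1.
Qed.

(** Three cases. On the plateau [w x] is the maximum. On an interval shorter than half of [|x - p|]
    the profile exceeds [w x] by a factor of at most [2 * N]. On a longer interval the total mass is
    compared with [(b - a) * w x]; the [n] dyadic shells of the tail weigh about [n * L], no more
    than the plateau once [n <= N]. *)
Lemma pointwise_A1_peak p n (N : R) : 1 <= N -> n%:R <= N ->
  pointwise_A1 (13 * N) (peak p (N * 2 ^+ n) (2 ^+ n)).
Proof.
move=> N1 nN a b x ab axb.
have L1 : 1 <= (2 : R) ^+ n by rewrite exprn_ege1 //; lra.
set L := _ ^+ n in L1 *.
have LH : L <= N * L by rewrite ler_peMl // (le_trans ler01).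
have H1 : 1 <= N * L by rewrite (le_trans L1).
have px1 := peak_ge1 p L x H1.
have mp := measurable_peak p (N * L) L.
have p0 y : 0 <= peak p (N * L) L y by rewrite (le_trans ler01) // peak_ge1.
have ba0 : 0 < b - a by rewrite subr_gt0.
have small : (forall y, a <= y <= b -> peak p (N * L) L y <= 2 * N * peak p (N * L) L x) ->
    (\int[mu]_(y in `[a, b]) (peak p (N * L) L y)%:E
      <= (13 * N * (b - a) * peak p (N * L) L x)%:E)%E.
  move=> le2; apply: le_trans (integral_itv_le_cst mp p0 (ltW ab) le2) _.
  rewrite lee_fin mulrAC ler_wpM2r // ler_wpM2r ?(ltW ba0) //.
  by rewrite ler_wpM2r ?(le_trans ler01 N1) //; lra.
case: (leP `|x - p| 1) => t1.
  apply: small => y _; rewrite {2}/peak t1.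
  have := @peak_le p (N * L) L y H1 LH (le_trans ler01 L1).
  by nra.
have t0 : 0 < `|x - p| by lra.
have pL : L * `|x - p|^-1 <= peak p (N * L) L x.
  by rewrite /peak ifF ?le_max ?lexx ?orbT // leNgt t1.
have pLt : L <= peak p (N * L) L x * `|x - p| by rewrite -ler_pdivrMr.
case: (leP (b - a) (`|x - p| / 2)) => bat.
  apply: small => y ayb.
  have xy : `|x - p| / 2 <= `|y - p|.
    have : `|x - p| <= `|x - y| + `|y - p|.
      by rewrite (le_trans _ (ler_normD _ _)) // (_ : x - y + (y - p) = x - p) //; lra.
    have : `|x - y| <= b - a.
      by move: axb ayb => /andP[? ?] /andP[? ?]; rewrite ler_norml; apply/andP; split; lra.
    by lra.
  (* The factor [N] is lost only when [y] lies on the plateau and [x] does not; on the tail, halving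
     the distance costs a factor [2]. *)
  rewrite {1}/peak; case: (leP `|y - p| 1) => y1.
    rewrite (mulrC 2) -mulrA ler_wpM2l ?(le_trans ler01 N1) //; nra.
  have N0 : 0 <= N by lra.
  rewrite ge_max; apply/andP; split; first by nra.
  rewrite ler_pdivrMr ?(lt_trans ltr01) //.
  set P := peak _ _ _ x in px1 pLt *.
  have h : P * `|x - p| <= 2 * (P * `|y - p|) by nra.
  apply: (le_trans pLt); apply: (le_trans h).
  by rewrite (mulrC 2 N) -!mulrA ler_peMl // mulr_ge0 // mulr_ge0 //; lra.
(* Beyond distance [L = 2 ^+ n] the peak is already [1], so truncating at scale [n] loses
   nothing. *)
apply: (@le_trans _ _ (b - a + 2 * (N * L) + 4 * n%:R * L)%:E).
  apply: le_trans (integral_peak_trunc p n H1 (le_trans ler01 L1) (ltW ab)).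
  have mT : measurable_fun setT
      (fun y => if `|y - p| <= 2 ^+ n then peak p (N * L) L y else 1).
    apply: measurable_fun_ifT; first exact: measurable_dist_le.
      exact: mp.
    exact: measurable_cst.
  apply: ge0_le_integral => //.
  - by move=> y _; rewrite lee_fin.
  - by apply/measurable_EFinP; apply: measurable_funTS.
  - by apply/measurable_EFinP; apply: measurable_funTS.
  move=> y _; rewrite lee_fin; case: ifPn => //; rewrite -ltNge => dy.
  rewrite peak_eq1 //; last exact: ltW.
  exact: le_lt_trans dy.
rewrite lee_fin; set P := peak _ _ _ x in px1 pLt *.
(* In units of [N * (b - a) * P] the three terms of the mass bound are at most [1], [4] and [8],
   whence [13]. *)
have h1 : L <= 2 * ((b - a) * P).
  apply: (le_trans pLt); rewrite mulrCA mulrC; nra.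
have h2 : n%:R * L <= N * L by rewrite ler_wpM2r // (le_trans ler01).
have h3 : b - a <= (b - a) * P by nra.
have h4 : N * L <= 2 * (N * ((b - a) * P)) by nra.
have h5 : (b - a) * P <= N * ((b - a) * P) by nra.
by rewrite -!mulrA; lra.
Qed.

(** * The comb: teeth at dyadic positions *)

(** The tooth at [4 * 2 ^+ k] differs from [1] only between [3 * 2 ^+ k] and [5 * 2 ^+ k], and the
    next cut is at [6 * 2 ^+ k]; so both sides equal [1] at every cut, as gluing requires. *)
Fixpoint comb N k : R -> R :=
  if k is k'.+1 then
    fun x => if x < 3 * 2 ^+ k then comb N k' x
             else peak (4 * 2 ^+ k) (N%:R * 2 ^+ k) (2 ^+ k) x
  else fun=> 1.

Lemma exp2S_ge2 n : 2 <= (2 : R) ^+ n.+1.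
Proof. by rewrite exprS ler_peMr // exprn_ege1 //; lra. Qed.

Lemma measurable_comb N k : measurable_fun setT (comb N k).
Proof.
elim: k => [|k IHk] /=; first exact: measurable_cst.
apply: measurable_fun_ifT => //; last exact: measurable_peak.
by apply: measurable_fun_ltr => //; exact: measurable_cst.
Qed.

Lemma natr_exp2_ge1 N k : 1 <= (N.+1%:R : R) * 2 ^+ k.
Proof.
by rewrite mulr_ege1 ?ler1n // exprn_ege1 // ler1n.
Qed.

Lemma comb_ge1 N k x : 1 <= comb N.+1 k x.
Proof.
elim: k => [|k IHk] //=; case: ifP => // _.
by rewrite peak_ge1 // natr_exp2_ge1.
Qed.

Lemma comb_le N k x : comb N.+1 k x <= N.+1%:R * 2 ^+ k.
Proof.
elim: k => [|k IHk] /=; first by rewrite expr0 mulr1 ler1n.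
have L0 n : 0 <= (2 : R) ^+ n by rewrite exprn_ge0.
case: ifP => _.
  apply: (le_trans IHk); rewrite ler_wpM2l // ler_weXn2l //; lra.
by rewrite peak_le ?natr_exp2_ge1 // ler_peMl // ler1n.
Qed.

Lemma comb_right N k x : 3 * 2 ^+ k.+1 <= x -> comb N k x = 1.
Proof.
case: k => [//|k] /=.
rewrite exprS; have := exp2S_ge2 k; set L := 2 ^+ k.+1 => L2 Lx.
rewrite ifF; last by apply/negbTE; rewrite -leNgt; lra.
have d : 2 * L <= `|x - 4 * L| by rewrite ger0_norm; lra.
by rewrite peak_eq1 //; lra.
Qed.

(** The first tooth, at [8] with scale [2], starts at [6]; hence the weight is [1] on the support of
    the test function. *)
Lemma comb_left N k x : x <= 6 -> comb N k x = 1.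
Proof.
move=> x6; elim: k => [//|k IHk] /=.
move: IHk; have := exp2S_ge2 k; set L := 2 ^+ k.+1 => L2 IHk.
case: ltP => // Lx.
have d : L <= `|x - 4 * L| by rewrite ler0_norm; lra.
by rewrite peak_eq1 //; lra.
Qed.

(** Later gluings change the comb only from [6 * 2 ^+ j.+1] on, past the end of this tooth. *)
Lemma comb_tooth N k j x : (j < k)%N ->
  3 * 2 ^+ j.+1 <= x -> x <= 5 * 2 ^+ j.+1 ->
  comb N k x = peak (4 * 2 ^+ j.+1) (N%:R * 2 ^+ j.+1) (2 ^+ j.+1) x.
Proof.
elim: k => [//|k IHk]; rewrite ltnS leq_eqVlt => /orP[/eqP-> lx _|jk lx ux] /=.
  by rewrite ltNge lx.
rewrite ifT ?IHk // (le_lt_trans ux) //.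
apply: (@lt_le_trans _ _ (3 * 2 ^+ j.+2)).
  by rewrite [in ltRHS]exprS; have := exp2S_ge2 j; lra.
by rewrite ler_wpM2l // ler_weXn2l //; lra.
Qed.

(** Gluing does not increase the constant, so the bound for one tooth survives all inductive steps.
    The restriction on [k] keeps the number of dyadic shells of each tooth below its height
    factor. *)
Lemma pointwise_A1_comb N k : (k <= N.+1)%N ->
  pointwise_A1 (13 * N.+1%:R) (comb N.+1 k).
Proof.
have N1 : 1 <= (N.+1%:R : R) by rewrite ler1n.
elim: k => [_|k IHk kN] /=.
  move=> a b x ab _.
  apply: le_trans (@integral_itv_le_cst (fun=> 1) a b 1 (measurable_cst _) _
    (ltW ab) _) _ => //.
  by rewrite lee_fin mulr1 ler_wpM2r ?subr_ge0 ?(ltW ab) //; lra.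
apply: pointwise_A1_glue.
- exact: measurable_comb.
- exact: measurable_peak.
- by lra.
- by move=> x; exact: comb_ge1.
- by move=> x; rewrite peak_ge1 // natr_exp2_ge1.
- by rewrite comb_right.
- have := exp2S_ge2 k; set L := 2 ^+ k.+1 => L2.
  have d : `|3 * L - 4 * L| = L by rewrite ler0_norm; lra.
  by rewrite peak_eq1 // d //; lra.
- by apply: IHk; exact: ltnW.
- by apply: pointwise_A1_peak => //; rewrite ler_nat.
Qed.

(** * The weights, with [A_1] constant comparable to [N] *)

Lemma bounded_itv_integrable w a b C :
  measurable_fun setT w -> (forall x, 0 <= w x) -> (forall x, w x <= C) ->
  a <= b -> mu.-integrable `[a, b] (EFin \o w).
Proof.
move=> mw w0 wC ab; apply/integrableP; split.
  by apply/measurable_EFinP; exact: measurable_funTS.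
apply: le_lt_trans (ltry (C * (b - a))).
rewrite (@eq_integral_EFin _ (fun x => `|w x|) w); last by move=> y _; rewrite ger0_norm.
by apply: integral_itv_le_cst.
Qed.

Lemma A1_cond_pointwise C w : 0 < C -> (forall x, 0 <= w x) ->
  pointwise_A1 C w -> A1_cond w C.
Proof.
move=> C0 w0 Aw; split => // a b ab; apply: aeW => x; rewrite inE /= in_itv /= => axb.
rewrite /avg mulrC ler_pdivrMr ?subr_gt0 // mulrAC.
have I := Aw a b x ab axb.
rewrite -lee_fin /Rintegral fineK //.
rewrite ge0_fin_numE ?(le_lt_trans I) ?ltry //.
by apply: integral_ge0 => y _; rewrite lee_fin.
Qed.

(** The shift to [N.+1] keeps the height factor at least [1] when [N = 0]. *)
Definition comb_weight N : R -> R := comb N.+1 N.+1.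

Lemma comb_weight_ge0 N x : 0 <= comb_weight N x.
Proof. exact: le_trans (comb_ge1 _ _ _). Qed.

Lemma comb_weight_integrable N a b : mu.-integrable `[a, b] (EFin \o comb_weight N).
Proof.
case: (leP a b) => ab.
  apply: bounded_itv_integrable ab; first exact: measurable_comb.
    exact: comb_weight_ge0.
  by move=> x; exact: comb_le.
by rewrite set_itv_ge ?bnd_simp -?ltNge //; exact: integrable_set0.
Qed.

Lemma comb_weight_A1_cond N : A1_cond (comb_weight N) (13 * N.+1%:R).
Proof.
apply: A1_cond_pointwise; first by rewrite mulr_gt0.
  exact: comb_weight_ge0.
exact: pointwise_A1_comb.
Qed.

Lemma comb_weight_A1 N : A1 (comb_weight N).
Proof.
split; last by exists (13 * N.+1%:R); exact: comb_weight_A1_cond.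
split; [exact: comb_weight_ge0|exact: comb_weight_integrable].
Qed.

Lemma comb_weight_tooth N j x : (j < N.+1)%N -> `|x - 4 * 2 ^+ j.+1| <= 1 ->
  comb_weight N x = N.+1%:R * 2 ^+ j.+1.
Proof.
move=> jN xj; have L2 := exp2S_ge2 j.
have /andP[lx ux] : 3 * 2 ^+ j.+1 <= x <= 5 * 2 ^+ j.+1.
  by move: xj; rewrite ler_norml => /andP[? ?]; apply/andP; split; lra.
by rewrite /comb_weight (comb_tooth _ jN lx ux) /peak xj.
Qed.

Lemma integral_cst_itv (C a b : R) : a <= b ->
  (\int[mu]_(y in `[a, b]) C%:E = (C * (b - a))%:E)%E.
Proof.
move=> ab; rewrite integral_cst // EFinM; congr (_ * _)%E; exact: lebesgue_measure_itvcc.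
Qed.

(** The test interval [[8, 10]] straddles the edge [9] of the first plateau: its left half alone
    gives average at least [N.+1], while the weight is at most [2] on the right half. *)
Lemma comb_weight_A1_cond_ge N C : A1_cond (comb_weight N) C -> N.+1%:R / 2 <= C.
Proof.
move=> [C0 /(_ 8 10)]; have -> : (8 : R) < 10 by rewrite ltr_nat.
move=> /(_ isT) [A [mA A0 sA]].
(* The exceptional null set cannot contain []9, 10]], which has measure [1]. *)
have [x [xl xu] Hx] : exists2 x : R, 9 < x /\ x <= 10 &
    avg (comb_weight N) 8 10 <= C * comb_weight N x.
  apply: contrapT => nx.
  have : (mu `]9%R, 10%R] <= mu A)%E.
    apply: le_measure; rewrite ?inE //.
    move=> x /=; rewrite in_itv /= => /andP[lx ux]; apply: sA => /= h; apply: nx.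
    exists x => //; apply: h; rewrite inE /= in_itv /=; apply/andP; split => //; lra.
  have -> : mu A = 0%E by exact: A0.
  rewrite lebesgue_measure_itv /= lte_fin ltr_nat /= -EFinB lee_fin; lra.
have wx : comb_weight N x <= 2.
  rewrite /comb_weight (@comb_tooth _ _ 0) //; try lra.
  have -> : (4 : R) * 2 ^+ 1 = 8 by lra.
  have x8 : 1 < `|x - 8| by rewrite ger0_norm; lra.
  rewrite /peak ifF; last by rewrite leNgt x8.
  rewrite ge_max ler_pdivrMr ?(lt_trans ltr01) //; apply/andP; split; lra.
suff : N.+1%:R <= avg (comb_weight N) 8 10.
  by have := comb_weight_ge0 N x; nra.
rewrite /avg (_ : 10 - 8 = 2); last by lra.
rewrite mulrC ler_pdivlMr // -lee_fin /Rintegral fineK; last first.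
  exact: integrable_fin_num (comb_weight_integrable N 8 10).
have -> : ((N.+1%:R * 2)%:E = \int[mu]_(y in `[8%R, 9%R]) (N.+1%:R * 2 : R)%:E)%E.
  by rewrite integral_cst_itv ?ler_nat // (_ : 9 - 8 = 1) ?mulr1 //; lra.
have mw : measurable_fun setT (comb_weight N) by exact: measurable_comb.
apply: (@le_trans _ _ (\int[mu]_(y in `[8%R, 9%R]) (comb_weight N y)%:E)%E).
  apply: ge0_le_integral => //.
    by apply/measurable_EFinP; exact: measurable_funTS.
  move=> y /=; rewrite in_itv /= => /andP[ly uy]; rewrite lee_fin.
  rewrite (@comb_weight_tooth _ 0) // ler_norml; apply/andP; split; lra.
apply: ge0_subset_integral => //.
- by apply/measurable_EFinP; exact: measurable_funTS.
- by move=> y _; rewrite lee_fin comb_weight_ge0.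
- by move=> y /=; rewrite !in_itv /= => /andP[-> ?] /=; lra.
Qed.

Lemma A1_const_comb_weight_le N : A1_const (comb_weight N) <= 13 * N.+1%:R.
Proof.
by apply: ge_inf; [exists 0 => C [/ltW] | exact: comb_weight_A1_cond].
Qed.

Lemma A1_const_comb_weight_ge N : N.+1%:R / 2 <= A1_const (comb_weight N).
Proof.
apply: lb_le_inf; first by exists (13 * N.+1%:R); exact: comb_weight_A1_cond.
by move=> C; exact: comb_weight_A1_cond_ge.
Qed.

(** * The union of the plateaux and the weak norm *)

Definition teeth N : set R :=
  \bigcup_(j < N) `[4 * 2 ^+ j.+1 - 1, 4 * 2 ^+ j.+1 + 1]%classic.

Lemma lebesgue_measure_teeth N : mu (teeth N) = (2 * N%:R)%:E.
Proof.
pose F j : set R := `[4 * 2 ^+ j.+1 - 1, 4 * 2 ^+ j.+1 + 1]%classic.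
rewrite /teeth bigcup_mkord; transitivity (\sum_(j < N) mu (F j))%E; last first.
  rewrite (eq_bigr (fun=> 2%:E)).
    by rewrite sumEFin sumr_const card_ord mulr_natr.
  move=> j _; transitivity ((4 * 2 ^+ j.+1 + 1 - (4 * 2 ^+ j.+1 - 1))%:E : \bar R).
    by apply: lebesgue_measure_itvcc; lra.
  by congr EFin; lra.
apply: (@measure_bigsetU _ _ _ mu) => [j|]; first exact: measurable_itv.
apply: ltn_trivIset => j i ij; apply/seteqP; split => x //= [].
rewrite /F /= !in_itv /= => /andP[li ui] /andP[lj uj].
(* Centres at least double, so they are at least [8] apart, while each plateau has length [2]. *)
have e : 2 * (2 : R) ^+ i.+1 <= 2 ^+ j.+1.
  by rewrite -exprS ler_weXn2l //; lra.
have := exp2S_ge2 i; lra.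
Qed.

Lemma weak_norm_ge_teeth N (E : R -> set R) (alpha : R) : 0 < alpha ->
  teeth N `<=` E alpha -> ((alpha * (2 * N%:R))%:E <= weak_norm E)%E.
Proof.
move=> a0 tE; apply: (@le_trans _ _ (alpha%:E * mu (E alpha))%E); last first.
  by apply: ereal_sup_ubound; exists alpha.
rewrite EFinM lee_pmul2l // -lebesgue_measure_teeth.
(* Monotonicity of the outer measure applies to an arbitrary set [E alpha]. *)
exact: le_mu_ext.
Qed.

(** * Both operators on the indicator of the unit interval *)

Local Notation unit_indic := (\1_(`[0%R, 1%R]%classic : set R) : R -> R).

Lemma unit_indic_div_comb_weight N :
  (fun y => unit_indic y / comb_weight N y) = unit_indic.
Proof.
apply/funext => y; rewrite indicE; case: (boolP (y \in _)) => [|_]; last by rewrite mul0r.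
rewrite inE /= in_itv /= => /andP[_ y1].
by rewrite /comb_weight comb_left ?divr1 //; lra.
Qed.

Lemma integral_unit_indic :
  (\int[mu]_x (`|unit_indic x|)%:E = 1)%E.
Proof.
rewrite (@eq_integral_EFin _ _ unit_indic); last first.
  by move=> x _; rewrite indicE normr_nat.
rewrite integral_indic // setIT; transitivity ((1 - 0)%:E : \bar R).
  exact: lebesgue_measure_itvcc.
by rewrite subr0.
Qed.

(** The interval [[0, x]] contains the whole unit mass. *)
Lemma maximal_unit_indic_ge x : 1 <= x ->
  (x^-1%:E <= maximal unit_indic x)%E.
Proof.
move=> x1; apply: ereal_sup_ubound; exists 0, x.
split; first by lra.
split; first by apply/andP; split; lra.
rewrite subr0 (@eq_integral_EFin _ _ unit_indic); last first.
  by move=> y _; rewrite indicE normr_nat.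
rewrite integral_indic // (setIidl _); last first.
  by move=> y /=; rewrite !in_itv /= => /andP[-> ?] /=; lra.
rewrite -[LHS]mule1; congr (_ * _)%E; rewrite -[in LHS](subr0 1).
by apply/esym; exact: lebesgue_measure_itvcc.
Qed.

(* [x] stays at distance at least [1] from the unit interval, so the truncated
   integrals are constant for [eps < 1]. *)
Lemma hilbert_pv_unit_indic x : 2 <= x ->
  exists2 L, hilbert_pv unit_indic x L & x^-1 <= L.
Proof.
move=> x2; pose F y : R := unit_indic y / (x - y).
exists (Rintegral mu setT F).
  apply: cvg_near_cst; near=> eps.
  rewrite /hilbert_trunc Rintegral_mkcond; congr (Rintegral _ _ _).
  apply/funext => y; rewrite patchE; case: ifPn => // /negP; rewrite inE /= => ny.
  rewrite /F indicE memNset ?mul0r //= in_itv /= => /andP[y0 y1]; apply: ny.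
  have e1 : eps < 1 by near: eps; exact: nbhs_right_lt.
  by rewrite ger0_norm; lra.
(* On the support [x - y] is positive; this form gives both measurability and nonnegativity of the
   integrand. *)
have FE y : F y = unit_indic y * `|y - x|^-1.
  rewrite /F indicE; case: (boolP (y \in _)) => [|_]; last by rewrite !mul0r.
  rewrite inE /= in_itv /= => /andP[y0 y1].
  by rewrite ler0_norm ?opprB //; lra.
have mI : measurable_fun setT (fun y => unit_indic y).
  exact: measurable_indic.
have mF : measurable_fun setT F.
  rewrite (_ : F = fun y => unit_indic y * `|y - x|^-1); last exact/funext.
  by apply: measurable_funM => //; exact: measurable_inv_dist.
have F0 y : 0 <= F y by rewrite FE mulr_ge0 // indicE.
have FI y : F y <= unit_indic y.
  rewrite /F indicE; case: (boolP (y \in _)) => [|_]; last by rewrite mul0r.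
  rewrite inE /= in_itv /= => /andP[y0 y1].
  by rewrite mul1r invf_le1; lra.
have IF y : x^-1 * unit_indic y <= F y.
  rewrite /F indicE mulrC; case: (boolP (y \in _)) => [|_]; last by rewrite !mul0r.
  rewrite inE /= in_itv /= => /andP[y0 y1].
  by rewrite !mul1r lef_pV2 ?posrE; lra.
have I1 : (\int[mu]_y (unit_indic y)%:E = 1)%E.
  by rewrite -integral_unit_indic; apply: eq_integral_EFin => y _; rewrite indicE normr_nat.
(* Finiteness comes first, since [Rintegral] would turn an infinite integral into [0]. *)
have fF : (\int[mu]_y (F y)%:E)%E \is a fin_num.
  rewrite ge0_fin_numE; last by apply: integral_ge0 => y _; rewrite lee_fin.
  apply: (@le_lt_trans _ _ 1%E); last exact: ltry.
  rewrite -I1; apply: ge0_le_integral => //.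
  - by move=> y _; rewrite lee_fin.
  - exact/measurable_EFinP.
  - exact/measurable_EFinP.
  - by move=> y _; rewrite lee_fin.
rewrite -lee_fin /Rintegral fineK //.
have x0 : 0 <= x^-1 by rewrite invr_ge0; lra.
rewrite -[leLHS]mule1 -I1 -ge0_integralZl_EFin //; last exact/measurable_EFinP.
apply: ge0_le_integral => //.
- by move=> y _; rewrite mule_ge0 // lee_fin indicE.
- apply: emeasurable_funM; first exact: measurable_cst.
  exact/measurable_EFinP.
- exact/measurable_EFinP.
- by move=> y _; rewrite -EFinM lee_fin.
Unshelve. all: by end_near. Qed.

(** On the plateau of scale [L >= 2] one has [x <= 4 * L + 1 < 6 * L], while the weight is
    [N.+1 * L]: the scale cancels, so one level serves all teeth. *)
Lemma teeth_comb_weight N x : teeth N.+1 x -> 2 <= x /\ N.+1%:R / 6 < comb_weight N x / x.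
Proof.
move=> [j /= jN]; rewrite in_itv /= => /andP[lx ux].
rewrite (@comb_weight_tooth N j) //; last by rewrite ler_norml; apply/andP; split; lra.
have := exp2S_ge2 j; set L := 2 ^+ j.+1 in lx ux * => L2.
split; first by lra.
rewrite ltr_pdivlMr; last by lra.
rewrite -mulrA ltr_pM2l //; lra.
Qed.

End Weights.

Theorem theorem1p1 (R : realType) :
  exists c : R, 0 < c /\
  exists w : nat -> R -> R,
    (forall N, A1 (w N)) /\
    ((fun N => A1_const (w N)) @ \oo --> +oo) /\
    forall N, exists f : R -> R,
      (@lebesgue_measure R).-integrable [set: R] (fun x => (f x)%:E) /\
      (0 < \int[@lebesgue_measure R]_(x in [set: R]) (`|f x|)%:E)%E /\
      ((c * A1_const (w N) ^+ 2)%:E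
         * \int[@lebesgue_measure R]_(x in [set: R]) (`|f x|)%:E
         <= weak_norm (level_H (w N) f))%E /\
      ((c * A1_const (w N) ^+ 2)%:E
         * \int[@lebesgue_measure R]_(x in [set: R]) (`|f x|)%:E
         <= weak_norm (level_M (w N) f))%E.
Proof.
(* [507 = 3 * 13 ^ 2]: with [n = N.+1], the [A_1] constant is at most [13 * n], and level [n / 6]
   times measure [2 * n] is [n ^ 2 / 3]. *)
exists 507^-1; split; first by rewrite invr_gt0 ltr0n.
exists (@comb_weight R); split; first exact: comb_weight_A1.
split.
  apply: (@ger_cvgy _ _ _ _ (fun N => N.+1%:R / 2)).
    by near=> N; exact: A1_const_comb_weight_ge.
  apply/cvgryPge => A; have /cvgryPge/(_ (2 * A)) := @cvgr_idn R.
  move=> h; near=> N.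
  have : 2 * A <= N%:R by near: N; exact: h.
  by rewrite -[N.+1%:R]natr1; lra.
move=> N; exists (\1_(`[0, 1] : set R)).
have N1 : 0 < (N.+1%:R : R) / 6 by rewrite divr_gt0.
have cN : ((507^-1 * A1_const (@comb_weight R N) ^+ 2)%:E
    <= (N.+1%:R / 6 * (2 * N.+1%:R))%:E)%E.
  rewrite lee_fin.
  have := @A1_const_comb_weight_le R N; have := @A1_const_comb_weight_ge R N.
  set t := A1_const _; rewrite expr2; nra.
rewrite integral_unit_indic mule1; split; [|split; [by rewrite lte_fin ltr01|split]].
- apply/integrableP; split.
    by apply/measurable_EFinP; exact: measurable_indic.
  by have /= -> := @integral_unit_indic R; exact: ltry.
- apply: (le_trans cN); apply: weak_norm_ge_teeth => // x /teeth_comb_weight[x2 ax].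
  have [L Lpv xL] := hilbert_pv_unit_indic x2.
  exists L; rewrite unit_indic_div_comb_weight; split => //.
  apply: (lt_le_trans ax); rewrite ler_wpM2l ?comb_weight_ge0 //.
  exact: le_trans (ler_norm _).
- apply: (le_trans cN); apply: weak_norm_ge_teeth => // x /teeth_comb_weight[x2 ax].
  rewrite /level_M /= unit_indic_div_comb_weight.
  apply: (@lt_le_trans _ _ (comb_weight N x * x^-1)%:E); first by rewrite lte_fin.
  rewrite EFinM lee_wpmul2l ?lee_fin ?comb_weight_ge0 //.
  apply: maximal_unit_indic_ge; lra.
Unshelve. all: by end_near. Qed.
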